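(* Fix an integer $n > 1$ and let $$a(n) = \max_{0 \leq d \leq n-1} \left(\frac{d(n-1-d)}{n-1+d} + \frac{1}{n-1+d}\right),$$ where the maximum is over all integers $d$ with $0\le d\le n-1$. Then $$B^{a(n)} \ll N_n(B) \quad\text{as } B \rightarrow \infty,$$ i.e. there are constants $c>0$ and $B_0$ (depending on $n$) such that $N_n(B)\ge c\,B^{a(n)}$ for all $B\ge B_0$.
   Context: A subring of $\mathbb{Z}^n$ is a sublattice (additive subgroup) of $\mathbb{Z}^n$ that contains the multiplicative identity $(1,1,\ldots,1)$ and is closed under componentwise multiplication. For a positive integer $k$, $f_n(k)$ denotes the number of subrings of $\mathbb{Z}^n$ of finite index $k$, and $N_n(B) = \#\{S\subset \mathbb{Z}^n : S \text{ is a subring and } [\mathbb{Z}^n:S]\le B\} = \sum_{k\le B} f_n(k)$. *)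

(* Defs.v *)
From HB Require Import structures.
From mathcomp Require Import all_boot all_order all_algebra finmap.
From mathcomp Require Import all_classical all_reals all_analysis.

Set Implicit Arguments.
Unset Strict Implicit.
Unset Printing Implicit Defensive.

Import Order.TTheory GRing.Theory Num.Theory.

Local Open Scope classical_set_scope.
Local Open Scope card_scope.
Local Open Scope ring_scope.

(* {ffun 'I_n -> int} carries the componentwise ring structure of the library:
   its unit is the constant function 1 and its product is pointwise. *)
Definition Zn (n : nat) : pzRingType := {ffun 'I_n -> int}.

Definition is_subring n (S : set (Zn n)) : Prop := GRing.subring_closed [in S].

Definition coset n (S : set (Zn n)) (x : Zn n) : set (Zn n) :=
  [set x + s | s in S].

(* [Z^n : S] = k, k finite: the set of cosets of S is equipotent to
   {0, ..., k - 1}. *)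
Definition has_index n (S : set (Zn n)) (k : nat) : Prop :=
  range (coset S) #= `I_k.

Definition subrings_upto (R : realType) (n : nat) (B : R) : set (set (Zn n)) :=
  [set S | is_subring S /\ exists2 k : nat, has_index S k & k%:R <= B].

(* fset_set A is empty when A is infinite, so a positive lower bound on
   Ncount n B also asserts that this set is finite. *)
Definition Ncount (R : realType) (n : nat) (B : R) : nat :=
  #|` fset_set (@subrings_upto R n B)|%fset.

Definition a_term (R : realType) (n d : nat) : R :=
  d%:R * (n%:R - 1 - d%:R) / (n%:R - 1 + d%:R) + 1 / (n%:R - 1 + d%:R).

(* The maximum is folded from its own d = 0 term, so the seed of the fold does
   not affect its value. *)
Definition a_exp (R : realType) (n : nat) : R :=
  \big[Num.max/a_term R n 0]_(d < n) a_term R n d.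

(* Main.v *)
Require Import Defs.
From mathcomp Require Import all_boot all_order all_algebra finmap.
From mathcomp Require Import all_classical all_reals all_analysis.
From mathcomp Require Import ring lra zify.

(* Write n - 1 = d + e and let y_i = x_i - x_0 for x in Z^n. For t > 0 and a
   d x e integer matrix A, the x with t | y_j on the last e coordinates and
   t^2 | y_i - \sum_j A_ij y_j on the first d ones form a subgroup containing 1
   on which every y_i is divisible by t. It is closed under products, because
   the products y_i y'_i are all divisible by t^2; its index is t^(e + 2d), and
   it determines t and A mod t. Letting t range over [U, 2U) and the entries of
   A over [0, U) gives U^(de + 1) subrings of index at most (2U)^(e + 2d);
   taking U of order B^(1/(e + 2d)) yields the d-th term of the maximum. Taking
   all t, instead of only primes, is what avoids a logarithmic loss. *)

Set Implicit Arguments.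
Unset Strict Implicit.
Unset Printing Implicit Defensive.

Import Order.TTheory GRing.Theory Num.Theory.

Local Open Scope classical_set_scope.
Local Open Scope card_scope.
Local Open Scope ring_scope.

(** * Subrings, cosets and finiteness of the count *)

Lemma is_subringP n (S : set (Zn n)) :
  is_subring S <-> [/\ S 1, forall u v, S u -> S v -> S (u - v) &
                       forall u v, S u -> S v -> S (u * v)].
Proof.
split=> -[S1 SB SM].
  split; [by rewrite inE in S1 | move=> u v Su Sv.. ].
  - by move: (SB u v); rewrite !inE; apply.
  - by move: (SM u v); rewrite !inE; apply.
split; [by rewrite inE | move=> u v; rewrite !inE.. ]; [exact: SB | exact: SM].
Qed.

Section SubringClosure.
Variables (n : nat) (S : set (Zn n)).
Hypothesis subS : is_subring S.

Lemma subring1 : S 1. Proof. by case/is_subringP: subS. Qed.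

Lemma subringB u v : S u -> S v -> S (u - v).
Proof. by case/is_subringP: subS => _ + _; apply. Qed.

Lemma subring0 : S 0.
Proof. by rewrite -(subrr 1); apply: subringB; exact: subring1. Qed.

Lemma subringN u : S u -> S (- u).
Proof. by rewrite -sub0r; apply: subringB; exact: subring0. Qed.

Lemma subringD u v : S u -> S v -> S (u + v).
Proof. by move=> Su Sv; rewrite -[v]opprK; exact/subringB/subringN. Qed.

Lemma subringMn u k : S u -> S (u *+ k).
Proof.
move=> Su; elim: k => [|k IH]; first exact: subring0.
by rewrite mulrS; exact: subringD.
Qed.

Lemma eq_coset u v : coset S u = coset S v <-> S (u - v).
Proof.
split=> [E|Suv].
  have: coset S u u by exists 0; [exact: subring0 | rewrite addr0].
  by rewrite E => -[s Ss <-]; rewrite addrAC subrr add0r.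
rewrite /coset; apply/seteqP; split=> _ [s Ss <-].
  by exists (u - v + s); [exact: subringD | rewrite addrA [v + _]addrC subrK].
exists (s - (u - v)); first exact: subringB.
by rewrite opprB addrCA [u + _]addrC subrK addrC.
Qed.

(** Pigeonhole: two of the [k + 1] multiples 0, x, ..., kx share a coset, so some jx with 0 < j <= k
    lies in [S], and j divides [K!]. Allowing [K] above [k] gives one modulus for all subrings of
    bounded index. *)
Lemma index_fact_mul k K x : has_index S k -> (k <= K)%N -> S (x *+ K`!).
Proof.
move=> Sk kK; suff [j /andP[j0 jk] Sj] : exists2 j, (0 < j <= k)%N & S (x *+ j).
  have /dvdnP[q ->] : (j %| K`!)%N by rewrite dvdn_fact ?j0 ?(leq_trans jk).
  by rewrite mulnC mulrnA; exact: subringMn.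
apply: contrapT => nS.
have inj : {in `I_k.+1 &, injective (fun i => coset S (x *+ i))}.
  have le i j : (i <= j)%N -> (j < k.+1)%N ->
      coset S (x *+ j) = coset S (x *+ i) -> i = j.
    move=> ij jk /eq_coset; rewrite -mulrnBr// => Sij.
    apply/eqP; rewrite eqn_leq ij /= leqNgt; apply/negP => ltij; apply: nS.
    exists (j - i)%N => //; rewrite subn_gt0 ltij /=.
    by rewrite (leq_trans (leq_subr _ _)) // -ltnS.
  move=> i j; rewrite !inE /= => ik jk E.
  by case/orP: (leq_total i j) => ij; [apply: le | apply/esym/le].
have : `I_k.+1 #<= `I_k.
  rewrite -(card_le_eqr Sk).
  have /card_eqPle[_ h] := inj_card_eq inj.
  apply: card_le_trans h _; apply: subset_card_le => _ [i _ <-].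
  by exists (x *+ i).
by rewrite card_le_II ltnn.
Qed.

(** An index is computed by exhibiting a surjection onto a finite type whose fibres are the cosets
    of [S]. *)
Lemma has_index_quotient (F : finType) (f : Zn n -> F) :
  (forall y, exists x, f x = y) -> (forall x y, f x = f y <-> S (x - y)) ->
  has_index S #|F|.
Proof.
move=> /choice[g fg] fS; rewrite /has_index.
have inj : {in [set: 'I_#|F|] &, injective (fun i => coset S (g (enum_val i)))}.
  by move=> i j _ _ /eq_coset /fS; rewrite !fg => /enum_val_inj.
suff -> : range (coset S) =
    range (fun i : 'I_#|F| => coset S (g (enum_val i))).
  by apply: card_eq_trans (inj_card_eq inj) _; rewrite card_eq_sym card_II.
apply/seteqP; split=> _ [x _ <-]; last by exists (g (enum_val x)).
exists (enum_rank (f x)) => //; rewrite enum_rankK; apply/eq_coset/fS.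
by rewrite fg.
Qed.

End SubringClosure.

(* A subring of index at most K contains K! Z^n, so it is determined by its
   image modulo K!. *)
Lemma finite_subrings_upto (R : realType) n (B : R) :
  finite_set (@subrings_upto R n B).
Proof.
pose K := (Num.truncn B).+1; pose M := K`!.
have SM S x : @subrings_upto R n B S -> S (x *+ M).
  case=> subS [k Sk kB].
  have kK : (k <= K)%N.
    have B0 : 0 <= B by apply: le_trans kB; rewrite ler0n.
    have /andP[_ BK] := truncn_itv B0.
    by rewrite -(ler_nat R) (le_trans kB) // ltW.
  exact: index_fact_mul Sk kK.
have M0 : (0 < M)%N by exact: fact_gt0.
pose emb (r : {ffun 'I_n -> 'I_M}) : Zn n := [ffun i => (r i : nat)%:Z].
(* The trace of [S] on the representatives of [Z^n] modulo [M]; it takes values in a finite type. *)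
pose tr (S : set (Zn n)) : {set {ffun 'I_n -> 'I_M}} :=
  [set r | `[< S (emb r) >]]%SET.
have red (x : Zn n) : exists r y, x = emb r + y *+ M.
  have lt i : (absz (x i %% M)%Z < M)%N.
    by rewrite -ltz_nat gez0_abs ?modz_ge0 ?ltz_pmod // -lt0n.
  exists [ffun i => Ordinal (lt i)], [ffun i => (x i %/ M)%Z].
  apply/ffunP => i; rewrite ffunE ffunMnE !ffunE /=.
  rewrite gez0_abs ?modz_ge0 // -?lt0n // addrC {1}(divz_eq (x i) M).
  by rewrite -mulr_natr natz.
have inj : {in @subrings_upto R n B &, injective tr}.
  have sub S S' : @subrings_upto R n B S -> @subrings_upto R n B S' ->
      tr S = tr S' -> S `<=` S'.
    move=> hS hS' E x; have [r [y ->]] := red x => Sx.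
    apply: subringD (SM _ _ hS'); first exact: hS'.1.
    suff: r \in tr S' by rewrite inE => /asboolP.
    rewrite -E inE; apply/asboolP; rewrite -(addrK (y *+ M) (emb r)).
    by apply: subringB Sx (SM _ _ hS); exact: hS.1.
  move=> S S'; rewrite !inE => hS hS' E.
  by apply/seteqP; split; apply: sub.
have /card_eqPle[_ h] := inj_card_eq inj.
exact: (card_le_finite h finite_finset).
Qed.

Lemma leq_card_Ncount (R : realType) n (B : R) (J : finType)
    (h : J -> set (Zn n)) :
  injective h -> (forall j, @subrings_upto R n B (h j)) ->
  (#|J| <= Ncount n B)%N.
Proof.
move=> injh hB; apply: leq_card_fset_set; first exact: finite_subrings_upto.
rewrite (card_le_eql card_II).
have inj : {in [set: 'I_#|J|] &, injective (fun i => h (enum_val i))}.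
  by move=> i j _ _ /injh /enum_val_inj.
have /card_eqPle[_ c] := inj_card_eq inj.
by apply: card_le_trans c _; apply: subset_card_le => _ [i _ <-].
Qed.

(** * Residues as elements of a finite type *)

Section Residue.
Variables (k : nat) (k0 : (0 < k)%N).

Lemma absz_modz_lt (z : int) : (absz (z %% k)%Z < k)%N.
Proof. by rewrite -ltz_nat gez0_abs ?modz_ge0 ?ltz_pmod // -lt0n. Qed.

Definition residue (z : int) : 'I_k := Ordinal (absz_modz_lt z).

Lemma eq_residue (z w : int) : residue z = residue w <-> (k %| z - w)%Z.
Proof.
rewrite -eqz_mod_dvd; split=> [/(congr1 val) /= E|/eqP E].
  rewrite -[(z %% k)%Z]gez0_abs ?modz_ge0 -?lt0n // E.
  by rewrite gez0_abs ?modz_ge0 -?lt0n.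
by apply: val_inj; rewrite /= E.
Qed.

Lemma residue_nat (i : 'I_k) : residue (i : nat) = i.
Proof. by apply: val_inj; rewrite /= modz_small //= ltz_nat. Qed.
End Residue.

(** * The subring attached to [t] and [A] *)

Section GraphLattice.
Variables (d e : nat).
Local Notation N := (Zn (d + e).+1).
Implicit Types (x u v : N) (t : nat) (A : 'I_d -> 'I_e -> nat).

Definition rel_coord x (i : 'I_(d + e)) : int := x (lift ord0 i) - x ord0.

(** The defect of the relative coordinates from the graph of [A], seen as a linear map from the last
    [e] coordinates to the first [d]. *)
Definition graph_form A x (i : 'I_d) : int :=
  rel_coord x (lshift e i) -
  \sum_(j < e) (A i j)%:Z * rel_coord x (rshift d j).

Definition graph_lattice t A : set N :=
  [set x | (forall j : 'I_e, (t %| rel_coord x (rshift d j))%Z) /\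
           (forall i : 'I_d, ((t ^ 2)%N %| graph_form A x i)%Z)].

Lemma rel_coordB u v i : rel_coord (u - v) i = rel_coord u i - rel_coord v i.
Proof. by rewrite /rel_coord !ffunE /=; ring. Qed.

Lemma rel_coord1 i : rel_coord 1 i = 0.
Proof. by rewrite /rel_coord !ffunE subrr. Qed.

Lemma rel_coordM u v i :
  rel_coord (u * v) i = rel_coord u i * rel_coord v i +
    (u ord0 * rel_coord v i + v ord0 * rel_coord u i).
Proof. by rewrite /rel_coord !ffunE /=; ring. Qed.

Lemma graph_formB A u v i :
  graph_form A (u - v) i = graph_form A u i - graph_form A v i.
Proof.
rewrite /graph_form rel_coordB; under eq_bigr do rewrite rel_coordB mulrBr.
by rewrite sumrB; ring.
Qed.

Lemma graph_form1 A i : graph_form A 1 i = 0.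
Proof.
rewrite /graph_form rel_coord1 big1 ?subrr // => j _.
by rewrite rel_coord1 mulr0.
Qed.

(** The first bracket contains only products of two relative coordinates, which [t ^ 2] divides on
    the lattice; the rest is a combination of graph forms. *)
Lemma graph_formM A u v i : graph_form A (u * v) i =
  (rel_coord u (lshift e i) * rel_coord v (lshift e i) -
   \sum_(j < e) (A i j)%:Z *
     (rel_coord u (rshift d j) * rel_coord v (rshift d j))) +
  (u ord0 * graph_form A v i + v ord0 * graph_form A u i).
Proof.
have E j : (A i j)%:Z * rel_coord (u * v) (rshift d j) =
    (A i j)%:Z * (rel_coord u (rshift d j) * rel_coord v (rshift d j)) +
    (u ord0 * ((A i j)%:Z * rel_coord v (rshift d j)) +
     v ord0 * ((A i j)%:Z * rel_coord u (rshift d j))).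
  by rewrite rel_coordM; ring.
rewrite /graph_form rel_coordM (eq_bigr _ (fun j _ => E j)).
rewrite !big_split /= -!mulr_sumr.
by ring.
Qed.

Lemma dvdz_mul_sqr t (a b : int) :
  (t %| a)%Z -> (t %| b)%Z -> ((t ^ 2)%N %| a * b)%Z.
Proof. by move=> ta tb; rewrite -mulnn PoszM dvdz_mul. Qed.

(** Modulo [t], each of the first [d] coordinates is a combination of the last [e], which vanish. *)
Lemma dvdz_rel_coord t A x i : graph_lattice t A x -> (t %| rel_coord x i)%Z.
Proof.
case=> xr xl; case: (split_ordP i) => j ->; last exact: xr.
have : (t %| graph_form A x j)%Z.
  by apply: dvdz_trans (xl j); rewrite -mulnn PoszM dvdz_mulr.
rewrite /graph_form rpredBr //; apply: rpred_sum => k _.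
by apply: dvdz_mull; exact: xr.
Qed.

Lemma graph_lattice_subring t A : is_subring (graph_lattice t A).
Proof.
apply/is_subringP; split=> [|u v hu hv|u v hu hv].
- by split=> i; rewrite ?rel_coord1 ?graph_form1 dvdz0.
- split=> i.
    by rewrite rel_coordB rpredB // (dvdz_rel_coord _ hu, dvdz_rel_coord _ hv).
  by rewrite graph_formB rpredB //; [case: hu | case: hv].
- have hu' i := dvdz_rel_coord i hu; have hv' i := dvdz_rel_coord i hv.
  split=> i.
    by rewrite rel_coordM !rpredD // dvdz_mull.
  rewrite graph_formM; apply: rpredD.
    apply: rpredB; first exact: dvdz_mul_sqr.
    by apply: rpred_sum => j _; apply: dvdz_mull; exact: dvdz_mul_sqr.
  by apply: rpredD; apply: dvdz_mull; [case: hv | case: hu].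
Qed.

Lemma zn_rel_coord (y : 'I_(d + e) -> int) : exists x, rel_coord x =1 y.
Proof.
exists [ffun i => if unlift ord0 i is Some j then y j else 0].
by move=> i; rewrite /rel_coord !ffunE liftK unlift_none subr0.
Qed.

(** The last relative coordinates modulo [t] and the graph forms modulo [t ^ 2] identify the
    quotient with (Z/t)^e x (Z/t^2)^d. *)
Lemma graph_lattice_index t A : (0 < t)%N ->
  has_index (graph_lattice t A) (t ^ (e + d.*2))%N.
Proof.
move=> t0; have t20 : (0 < t ^ 2)%N by rewrite expn_gt0 t0.
pose F : finType := ({ffun 'I_e -> 'I_t} * {ffun 'I_d -> 'I_(t ^ 2)})%type.
have <- : #|F| = (t ^ (e + d.*2))%N.
  by rewrite card_prod !card_ffun !card_ord -expnM -expnD mul2n.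
pose f x : F := ([ffun j => residue t0 (rel_coord x (rshift d j))],
                 [ffun i => residue t20 (graph_form A x i)]).
apply: (@has_index_quotient _ _ (graph_lattice_subring t A) F f).
  move=> [r l].
  (* Surjectivity is a triangular system: the last coordinates are [r], and the first ones are then
     [l] plus the image of [r] under [A]. *)
  pose y k := match fintype.split k with
    | inl i => (l i : nat)%:Z + \sum_(j < e) (A i j)%:Z * (r j : nat)%:Z
    | inr j => (r j : nat)%:Z end.
  have [x xy] := zn_rel_coord y; exists x.
  have xr j : rel_coord x (rshift d j) = (r j : nat)%:Z.
    by rewrite xy /y (unsplitK (inr j)).
  congr pair; apply/ffunP => i; rewrite ffunE.
    by rewrite xr residue_nat.
  rewrite /graph_form xy /y (unsplitK (inl i)).
  by under [X in _ + _ - X]eq_bigr do rewrite xr; rewrite addrK residue_nat.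
move=> u v; split=> [[/ffunP Er /ffunP El]|[hr hl]].
  split=> i; rewrite (rel_coordB, graph_formB).
    by apply/(eq_residue t0); have := Er i; rewrite !ffunE.
  by apply/(eq_residue t20); have := El i; rewrite !ffunE.
congr pair; apply/ffunP => i; rewrite !ffunE; apply/eq_residue.
  by rewrite -rel_coordB.
by rewrite -graph_formB.
Qed.

(** The test vector is [t] times the point of the graph of [A] over the j-th basis vector. Its
    membership in the lattice of [A'] says that [t ^ 2] divides [t] times the difference of the (i,
    j) entries. *)
Lemma graph_lattice_inj t A A' : (0 < t)%N ->
  graph_lattice t A = graph_lattice t A' ->
  forall i j, A i j = A' i j %[mod t].
Proof.
move=> t0 E i j.
pose y k := match fintype.split k with
  | inl i => t%:Z * (A i j)%:Z
  | inr j' => if j' == j then t%:Z else 0 end.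
have [x xy] := zn_rel_coord y.
have xr j' : rel_coord x (rshift d j') = if j' == j then t%:Z else 0.
  by rewrite xy /y (unsplitK (inr j')).
have form B k : graph_form B x k = t%:Z * ((A k j)%:Z - (B k j)%:Z).
  rewrite /graph_form xy /y (unsplitK (inl k)) (bigD1 j) //= xr eqxx.
  rewrite big1 => [|j' /negPf nj].
    by ring.
  by rewrite xr nj mulr0.
have Sx : graph_lattice t A x.
  split=> [j'|k]; first by rewrite xr; case: ifP.
  by rewrite form subrr mulr0 dvdz0.
rewrite E in Sx; case: Sx => _ /(_ i); rewrite form -mulnn PoszM.
rewrite dvdz_mul2l; last by rewrite -lt0n.
by rewrite -eqz_mod_dvd; move/eqP; rewrite !modz_nat => -[].
Qed.

End GraphLattice.

(** * Counting the family and optimizing *)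

Lemma leq_Ncount_graph (R : realType) (d e U : nat) (B : R) :
  (0 < d + e)%N -> (0 < U)%N -> (U.*2 ^ (e + d.*2))%:R <= B ->
  (U ^ (d * e).+1 <= Ncount (d + e).+1 B)%N.
Proof.
move=> de0 U0 UB.
pose J : finType := ('I_U * {ffun 'I_d * 'I_e -> 'I_U})%type.
have <- : #|J| = (U ^ (d * e).+1)%N.
  by rewrite card_prod card_ffun card_prod !card_ord expnS.
pose h (sA : J) := graph_lattice (U + sA.1) (fun i j => sA.2 (i, j) : nat).
apply: (@leq_card_Ncount _ _ _ J h).
  move=> [s A] [s' A'] E.
  have t0 (r : 'I_U) : (0 < U + r)%N by rewrite addn_gt0 U0.
  have p0 : (0 < e + d.*2)%N by lia.
  (* The modulus is recovered from the index, a power of it with positive exponent. *)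
  have ss' : s = s'.
    have i1 := graph_lattice_index (fun i j => A (i, j) : nat) (t0 s).
    have i2 := graph_lattice_index (fun i j => A' (i, j) : nat) (t0 s').
    move: i2; rewrite /h /= in E; rewrite /has_index -E card_eq_sym => i2.
    have /card_eq_II/eqP := card_eq_trans i2 i1.
    by rewrite eqn_exp2r // eqn_add2l eq_sym => /eqP/val_inj.
  subst s'; congr pair; apply/ffunP => -[i j]; apply: val_inj.
  (* The entries are below [U], hence below the modulus [U + s], so congruence is equality. *)
  have := graph_lattice_inj (t0 s) E i j => /=.
  by rewrite !modn_small // (leq_trans (ltn_ord _)) // leq_addr.
move=> [s A]; split; first exact: graph_lattice_subring.
exists ((U + s) ^ (e + d.*2))%N.
  by apply: graph_lattice_index; rewrite addn_gt0 U0.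
apply: le_trans UB; rewrite ler_nat leq_exp2r; last by lia.
by rewrite -addnn leq_add2l ltnW.
Qed.

Lemma powR_le_Ncount (R : realType) (d e : nat) : (0 < d + e)%N ->
  exists2 c : R, 0 < c & exists B0 : R, forall B : R, B0 <= B ->
    c * B `^ ((d * e).+1%:R / (e + d.*2)%:R) <= (Ncount (d + e).+1 B)%:R.
Proof.
move=> de0; set p := (e + d.*2)%N; set q := (d * e).+1.
have p0 : (0 < p%:R :> R) by rewrite ltr0n /p; lia.
(* With [b] the p-th root of [B], the bound [B >= 2 ^ p] gives b/2 >= 1. Hence the integer part [U]
   of b/2 is at least 1, and b/2 < U + 1 <= 2U, that is, U > b/4. *)
exists (4 ^- q); first by rewrite invr_gt0 exprn_gt0.
exists (2 ^+ p) => B pB.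
have B0 : 0 <= B by apply: le_trans pB; rewrite exprn_ge0.
pose b := B `^ p%:R^-1.
have bp : b ^+ p = B.
  by rewrite -powR_mulrn ?powR_ge0 // -powRrM mulVf ?powRr1 ?gt_eqF.
have b2 : 2 <= b.
  by rewrite -(@ler_pXn2r _ p) ?nnegrE ?powR_ge0 ?bp // -(ltr0n R).
have b20 : 0 <= b / 2 by lra.
pose U := Num.truncn (b / 2).
have /andP[Ub bU] := truncn_itv b20; rewrite -/U -[U.+1%:R]natr1 in Ub bU.
have U1 : 1 <= U%:R :> R by rewrite ler1n truncn_gt0; lra.
have bE : B `^ (q%:R / p%:R) = b ^+ q.
  by rewrite mulrC powRrM -/b powR_mulrn // powR_ge0.
rewrite bE; apply: (@le_trans _ _ (U ^ q)%:R); last first.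
  rewrite ler_nat; apply: leq_Ncount_graph => //; first by rewrite -(ler1n R).
  rewrite natrX -bp ler_pXn2r ?nnegrE ?ler0n ?powR_ge0 // -?(ltr0n R) //.
  by rewrite -muln2 natrM; lra.
rewrite natrX mulrC ler_pdivrMr ?exprn_gt0 // -exprMn.
by rewrite lerXn2r ?nnegrE ?powR_ge0 //; lra.
Qed.

Local Close Scope card_scope.
Local Close Scope classical_set_scope.

Theorem theorem1p6 (R : realType) (n : nat) (hn : (1 < n)%N) :
  exists2 c : R, 0 < c &
    exists B0 : R, forall B : R, B0 <= B ->
      c * B `^ (a_exp R n) <= (Ncount n B)%:R.
Proof.
case: n hn => // m m0.
(* A finite maximum is attained; the seed of the fold is itself the term at [d = 0]. *)
have [d ->] : exists d : 'I_m.+1, a_exp R m.+1 = a_term R m.+1 d.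
  rewrite /a_exp.
  elim/big_ind: _ => [|x y [i ->] [j ->]|i _]; [by exists ord0 | | by exists i].
  by rewrite /Num.max; case: ifP => _; [exists j | exists i].
have dm : (d <= m)%N by rewrite -ltnS.
have mE : (d + (m - d))%N = m by rewrite subnKC.
have [|c c0 [B0 H]] := @powR_le_Ncount R d (m - d); first by rewrite mE.
exists c => //; exists B0 => B /H; rewrite mE; congr (_ * _ `^ _ <= _).
(* With e = m - d, the term is (de + 1)/(m + d), and m + d = e + 2d. *)
rewrite /a_term -mulrDl -[m.+1%:R]natr1 addrK -natr1 natrM natrB //.
by congr (_ / _); rewrite -addnn addnA subnK // natrD.
Qed.
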